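(* Let $\mathcal{A}$ be a family of functions, each $g\in\mathcal{A}$ a function $g:\mathbf{No}^{m_g}\to\mathbf{No}$, such that for every initial $T\subseteq\mathbf{No}$ the closure $\mathrm{cl}_{\mathcal{A}}(T)$ is initial. Let $f:\mathbf{No}^n\to\mathbf{No}$ be recursive over $\mathcal{A}$ (not necessarily uniformly). Let $S_1,\dots,S_n$ be initial subclasses of $\mathbf{No}$ and $S:=S_1\times\dots\times S_n$. Then $\mathrm{cl}_{\mathcal{A}}(S_1\cup\dots\cup S_n\cup f(S))$ is initial. Moreover, if every option of $f$ is a function only of the values $f(\vec x^{\,\sigma(1)}),\dots,f(\vec x^{\,\sigma(k)})$, then $\mathrm{cl}_{\mathcal{A}}(f(S))$ is initial.
   Context: $\mathbf{No}$ is the class of surreal numbers (sign sequences $x:\alpha\to\{+,-\}$, $\alpha$ an ordinal) with its usual order $<$; $y\prec x$ means $y$ is a proper initial segment (restriction to a smaller ordinal) of $x$, and $y\preceq x$ means $y\prec x$ or $y=x$. For sets $L<R$, $\{L\mid R\}$ is the simplest ($\preceq$-least) $x$ with $L<x<R$. A subclass $S$ is initial iff $x\in S$ and $y\preceq x$ imply $y\in S$. For a family $\mathcal{A}$ of functions $g:\mathbf{No}^{m_g}\to\mathbf{No}$, a class $T$ is closed under $\mathcal{A}$ iff $g(T^{m_g})\subseteq T$ for every $g\in\mathcal{A}$, and $\mathrm{cl}_{\mathcal{A}}(S)$ is the smallest class containing $S$ and closed under $\mathcal{A}$. Recursive functions of $n$ variables: on $\mathbf{No}^n$, $\vec y\preceq\vec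 x$ iff $y_i\preceq x_i$ for all $i$. Let $K=\{+,-,0\}^n\setminus\{(0,\dots,0)\}$, $k=3^n-1$, and fix an enumeration $\sigma(1),\dots,\sigma(k)$ of $K$. For $\sigma\in K$, $\vec y$ is a $\sigma$-option of $\vec x$ iff $\vec y\prec\vec x$ and for each $i$: $y_i<x_i$ iff $\sigma_i=-$, $y_i>x_i$ iff $\sigma_i=+$, $y_i=x_i$ iff $\sigma_i=0$. Given sets $L,R$ of functions (options), $f=\{L\mid R\}$ means that for all $\vec x\in\mathbf{No}^n$, $f(\vec x)=\{\,g(\vec x,\vec x^{\sigma(1)},\dots,\vec x^{\sigma(k)},f(\vec x^{\sigma(1)}),\dots,f(\vec x^{\sigma(k)})): g\in L \mid \text{same with } g\in R\,\}$, where each $\vec x^{\sigma(i)}$ ranges over the $\sigma(i)$-options of $\vec x$ (options may ignore some arguments, in which case the corresponding quantification is dropped). $f$ is recursive over $\mathcal{A}$ if such $L,R$ exist with $L,R\subseteq\mathcal{A}$ (the options being regarded as functions of their surreal arguments). *)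

(* Defs.v *)
From mathcomp Require Import all_boot.
From mathcomp Require Import classical_sets wochoice.

Set Implicit Arguments.
Unset Strict Implicit.
Unset Printing Implicit Defensive.

Local Open Scope classical_set_scope.

(* A fixed universe of "sets"; predicates [set T] over larger types play the
   role of (possibly proper) classes.  The ordinals and the surreal numbers
   below live one universe above [smallType], hence form proper classes. *)
Definition smallType := Type.

Definition is_small (T : Type) (A : set T) : Prop :=
  exists (I : smallType) (h : I -> T), A = range h.

(* Ordinals: isomorphism classes of well-ordered small types. *)

Record wellOrder := WellOrder {
  wo_sort : smallType;
  wo_le : rel wo_sort;
  wo_leP : well_order wo_le
}.

Definition wo_iso (V W : wellOrder) : Prop :=
  exists h : wo_sort V -> wo_sort W, bijective h /\
    forall u v, wo_le u v = wo_le (h u) (h v).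

(* V is isomorphic to the proper initial segment {u | u < w} of W. *)
Definition wo_shorter (V W : wellOrder) : Prop :=
  exists (w : wo_sort W) (h : wo_sort V -> wo_sort W),
    (forall u v, wo_le u v = wo_le (h u) (h v)) /\
    range h = [set u | wo_le u w /\ u <> w].

Record ordinalNumber := OrdinalNumber {
  ord_class : set wellOrder;
  ord_classP : exists W, ord_class = [set V | wo_iso V W]
}.

Definition ord_lt (a b : ordinalNumber) : Prop :=
  exists V W, [/\ ord_class a V, ord_class b W & wo_shorter V W].

(* Signs carry the order - < 0 < +. *)
Inductive sign := Minus | Zero | Plus.

Definition sign_lt (s t : sign) : Prop :=
  match s, t with
  | Minus, (Zero | Plus) | Zero, Plus => True
  | _, _ => False
  end.

(* A sign sequence len -> {+,-}, extended by the value Zero at the ordinals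
   outside its domain, so that surreals are equal iff their signs agree. *)
Record No := MkNo {
  len : ordinalNumber;
  sgn : ordinalNumber -> sign;
  sgn_dom : forall b, sgn b <> Zero <-> ord_lt b len
}.

Definition No_lt (x y : No) : Prop :=
  exists b, (forall c, ord_lt c b -> sgn x c = sgn y c) /\
    sign_lt (sgn x b) (sgn y b).

Definition prec (y x : No) : Prop :=
  ord_lt (len y) (len x) /\
  forall b, ord_lt b (len y) -> sgn y b = sgn x b.

Definition preceq (y x : No) : Prop := prec y x \/ y = x.

Definition is_initial (S : set No) : Prop :=
  forall x y, S x -> preceq y x -> S y.

Definition separates (L R : set No) (x : No) : Prop :=
  (forall l, L l -> No_lt l x) /\ (forall r, R r -> No_lt x r).

(* [is_cut L R x] states x = {L | R}; in particular it entails L < R. *)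
Definition is_cut (L R : set No) (x : No) : Prop :=
  separates L R x /\ forall z, separates L R z -> preceq x z.

Definition No_fun (m : nat) := ('I_m -> No) -> No.

(* A class of functions of arbitrary arities; arity 0 gives constants. *)
Definition No_family := forall m, set (No_fun m).

Definition closed_under (A : No_family) (T : set No) : Prop :=
  forall m (g : No_fun m), A m g ->
  forall v : 'I_m -> No, (forall i, T (v i)) -> T (g v).

Definition cl (A : No_family) (S : set No) : set No :=
  smallest (closed_under A) S.

Definition vec_preceq n (y x : 'I_n -> No) : Prop :=
  forall i, preceq (y i) (x i).

Definition vec_prec n (y x : 'I_n -> No) : Prop :=
  vec_preceq y x /\ y <> x.

Definition signIndex n := {s : 'I_n -> sign | exists i, s i <> Zero}.

Definition sigma_option n (s : signIndex n) (y x : 'I_n -> No) : Prop :=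
  vec_prec y x /\
  forall i, [/\ No_lt (y i) (x i) <-> sval s i = Minus,
                No_lt (x i) (y i) <-> sval s i = Plus &
                y i = x i <-> sval s i = Zero].

(* The surreal arguments available to an option: the coordinates of x, the
   coordinates of x^s, and the value f(x^s), for s in [signIndex n].  They are
   named rather than numbered, so no enumeration of the signs is needed. *)
Inductive slot n :=
  | SelfArg of 'I_n
  | OptArg of signIndex n & 'I_n
  | ValArg of signIndex n.

Arguments SelfArg {n}.
Arguments OptArg {n}.
Arguments ValArg {n}.

Definition slot_value n (f : No_fun n) (x : 'I_n -> No)
    (y : signIndex n -> 'I_n -> No) (t : slot n) : No :=
  match t with
  | SelfArg i => x i
  | OptArg s i => y s i
  | ValArg s => f (y s)
  end.

(* A function [opt_fun] of m surreal arguments, together with the m distinct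
   available arguments it takes; all the other ones are ignored. *)
Record opt n := Opt {
  opt_arity : nat;
  opt_fun : No_fun opt_arity;
  opt_arg : 'I_opt_arity -> slot n;
  opt_arg_inj : injective opt_arg
}.

Arguments opt_fun {n} o.
Arguments opt_arg {n} o.

Definition opt_uses n (o : opt n) (s : signIndex n) : Prop :=
  exists j, opt_arg o j = ValArg s \/ exists i, opt_arg o j = OptArg s i.

(* Only the x^s that o uses are required to range over s-options: if o ignores
   x^s and f(x^s), a lack of s-options of x does not make this set empty. *)
Definition opt_values n (f : No_fun n) (x : 'I_n -> No) (o : opt n) : set No :=
  [set z | exists y : signIndex n -> 'I_n -> No,
    (forall s, opt_uses o s -> sigma_option s (y s) x) /\
    z = opt_fun o (fun j => slot_value f x y (opt_arg o j))].

(* f = {L | R} *)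
Definition defined_by n (f : No_fun n) (L R : set (opt n)) : Prop :=
  forall x, is_cut (\bigcup_(o in L) opt_values f x o)
                   (\bigcup_(o in R) opt_values f x o) (f x).

Definition opts_in n (A : No_family) (L : set (opt n)) : Prop :=
  is_small L /\ forall o, L o -> A (opt_arity o) (opt_fun o).

Definition recursive_over n (A : No_family) (f : No_fun n) : Prop :=
  exists L R, [/\ opts_in A L, opts_in A R & defined_by f L R].

Definition values_only n (o : opt n) : Prop :=
  forall j, exists s, opt_arg o j = ValArg s.

Definition class_prod n (S : 'I_n -> set No) : set ('I_n -> No) :=
  [set x | forall i, S i (x i)].

(* Main.v *)
Require Import Defs.
From mathcomp Require Import all_boot.
From mathcomp Require Import boolp classical_sets wochoice.

(** Let [C] be the closure in question and [T] the largest initial class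
    contained in [C].  Since [cl A T] is initial and contained in [C], it is
    contained in [T]; thus [T] is closed under [A].  By induction on [x] in the
    product of the [S i], [f x] lies in [T]: the values of the options at [x]
    lie in [T], and every proper initial segment of a cut [{L | R}] is an
    initial segment of an element of [L] or [R].  Hence [C] is contained in
    [T], that is, [C] is initial. *)

Set Implicit Arguments.
Unset Strict Implicit.
Unset Printing Implicit Defensive.

Local Open Scope classical_set_scope.

(** * Well-founded relations and minimal elements *)

Lemma wf_of_minimal (X : Type) (r : X -> X -> Prop) :
  (forall P : set X, P !=set0 ->
     exists z, P z /\ forall y, r y z -> ~ P y) ->
  well_founded r.
Proof.
move=> minP; apply: contrapT => /existsNP[x nAx].
have [z [nAz zmin]] := minP [set y | ~ Acc r y] (ex_intro _ x nAx).
by apply: nAz; split=> y /zmin/contrapT.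
Qed.

Lemma wf_minimal (X : Type) (r : X -> X -> Prop) (P : set X) :
  well_founded r -> P !=set0 ->
  exists z, P z /\ forall y, r y z -> ~ P y.
Proof.
move=> wf_r [x Px]; apply: contrapT => nmin.
elim/(well_founded_ind wf_r): x Px => x IH Px.
by apply: nmin; exists x; split=> // y ryx /(IH y ryx).
Qed.

Lemma wf_irr (X : Type) (r : X -> X -> Prop) (x : X) :
  well_founded r -> ~ r x x.
Proof. by move=> wf_r; elim/(well_founded_ind wf_r): x => x IH /[dup] /IH. Qed.

(** * Well-orders *)

Lemma wo_minimum (W : wellOrder) (P : set (wo_sort W)) :
  P !=set0 -> exists2 z, P z & forall x, P x -> wo_le z x.
Proof.
move=> [x Px]; have [|z [[Pz zmin] _]] := @wo_leP W (fun y => `[< P y >]).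
  by exists x; apply/asboolP.
exists z; first by move/asboolP: Pz.
by move=> y Py; apply: zmin; apply/asboolP.
Qed.

Section WellOrderTheory.
Context {W : wellOrder}.
Implicit Types x y z : wo_sort W.

Definition wo_lt x y := wo_le x y /\ x <> y.

(** The axiom [wo_leP] provides a unique minimum for every nonempty predicate. The order axioms
    follow by applying it to classes of one, two and three elements; antisymmetry is where
    uniqueness enters. *)
Lemma wo_le_refl x : wo_le x x.
Proof.
have [|z zE zmin] := @wo_minimum W [set x]; first by exists x.
by rewrite -{1}zE; apply: zmin.
Qed.

Lemma wo_le_total x y : wo_le x y \/ wo_le y x.
Proof.
have [|z [->|->] zmin] := @wo_minimum W [set x; y]; first by exists x; left.
- by left; apply: zmin; right.
- by right; apply: zmin; left.
Qed.

Lemma wo_le_anti x y : wo_le x y -> wo_le y x -> x = y.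
Proof.
move=> xy yx.
have [|z [_ zuniq]] := @wo_leP W (fun u => `[< u = x \/ u = y >]).
  by exists x; apply/asboolP; left.
have <- : z = x.
  apply: zuniq; split; first by apply/asboolP; left.
  by move=> u /asboolP[->|->] //; apply: wo_le_refl.
apply: zuniq; split; first by apply/asboolP; right.
by move=> u /asboolP[->|->] //; apply: wo_le_refl.
Qed.

Lemma wo_lt_trichotomy x y : wo_lt x y \/ x = y \/ wo_lt y x.
Proof.
case: (pselect (x = y)) => [->|xy]; first by right; left.
case: (wo_le_total x y) => xy'; first by left.
by right; right; split=> // /esym.
Qed.

Lemma wo_lt_nle x y : wo_lt x y -> ~ wo_le y x.
Proof. by move=> [xy nxy] /(wo_le_anti xy). Qed.

Lemma wo_lt_trans y x z : wo_lt x y -> wo_lt y z -> wo_lt x z.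
Proof.
move=> xy yz.
have [|m mE mmin] := @wo_minimum W [set u | [\/ u = x, u = y | u = z]].
  by exists x; constructor.
have mx : wo_le m x by apply: mmin; constructor.
have my : wo_le m y by apply: mmin; constructor.
have mz : wo_le m z by apply: mmin; constructor.
have xz : wo_le x z.
  case: mE => mE; move: mx my mz; rewrite {}mE //.
  - by move=> /(wo_lt_nle xy).
  - by move=> _ /(wo_lt_nle yz).
split=> // xzE; move: xy; rewrite xzE => /wo_lt_nle; apply.
by case: yz.
Qed.

End WellOrderTheory.

Lemma wo_lt_wf (W : wellOrder) : well_founded (@wo_lt W).
Proof.
apply: wf_of_minimal => P /wo_minimum[z Pz zmin].
by exists z; split=> // y /wo_lt_nle + /zmin.
Qed.


Lemma wo_lt_ind (W : wellOrder) (P : wo_sort W -> Prop) :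
  (forall x, (forall y, wo_lt y x -> P y) -> P x) -> forall x, P x.
Proof. exact: well_founded_ind (@wo_lt_wf W) P. Qed.

(** * Comparison of well-orders *)

(* [sim v w] holds iff the initial segments below [v] and [w] are isomorphic;
   this bisimulation avoids carrying the isomorphisms around. *)
Inductive sim (V W : wellOrder) (v : wo_sort V) (w : wo_sort W) : Prop :=
  Sim of (forall v', wo_lt v' v -> exists2 w', wo_lt w' w & sim v' w')
       & (forall w', wo_lt w' w -> exists2 v', wo_lt v' v & sim v' w').

Lemma sim_sym (V W : wellOrder) (v : wo_sort V) (w : wo_sort W) :
  sim v w -> sim w v.
Proof.
elim/wo_lt_ind: v w => v IH w [vw wv].
by split=> [w' /wv|v' /[dup] v'v /vw] [u ? ?]; exists u => //; apply: IH.
Qed.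

Lemma sim_trans (U V W : wellOrder) (u : wo_sort U) (v : wo_sort V)
  (w : wo_sort W) : sim u v -> sim v w -> sim u w.
Proof.
elim/wo_lt_ind: u v w => u IH v w [uv vu] [vw wv].
split=> [u' /[dup] u'u /uv[v' /vw[w' w'w v'w'] u'v']|].
  by exists w' => //; apply: IH u'v' v'w'.
move=> w' /wv[v' /vu[u' u'u u'v'] v'w'].
by exists u' => //; apply: IH u'v' v'w'.
Qed.

Lemma sim_inj (V W : wellOrder) (v : wo_sort V) (w w' : wo_sort W) :
  sim v w -> sim v w' -> w = w'.
Proof.
(* Infinite descent: if [y] lies below [y'], then [y] is matched with some [x'] below [x], and [x']
   with some [z] below [y]. So [x'] is again matched with two comparable points. *)
have sim_nlt (x : wo_sort V) (y y' : wo_sort W) :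
    sim x y -> sim x y' -> ~ wo_lt y y'.
  elim/wo_lt_ind: x y y' => x IH y y' [xy yx] [_ y'x].
  move=> /y'x[x' /[dup] x'x /xy[z zy x'z] x'y].
  exact: IH x'z x'y zy.
move=> vw vw'.
case: (wo_lt_trichotomy w w') => [ww'|[//|w'w]].
  by case: (sim_nlt _ _ _ vw vw').
by case: (sim_nlt _ _ _ vw' vw).
Qed.

Lemma sim_mono (V W : wellOrder) (v v' : wo_sort V) (w w' : wo_sort W) :
  sim v w -> sim v' w' -> wo_lt v v' -> wo_lt w w'.
Proof. by move=> vw [+ _] => /[apply] -[u uw' /(sim_inj vw) ->]. Qed.

Lemma sim_wo_le (V W : wellOrder) (v v' : wo_sort V) (w w' : wo_sort W) :
  sim v w -> sim v' w' -> wo_le v v' = wo_le w w'.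
Proof.
have le_mono (X Y : wellOrder) (x x' : wo_sort X) (y y' : wo_sort Y) :
    sim x y -> sim x' y' -> wo_le x x' -> wo_le y y'.
  move=> xy xy' xx'; case: (pselect (x = x')) => [xE|nxx'].
    by rewrite -xE in xy'; rewrite (sim_inj xy xy'); apply: wo_le_refl.
  by have [] := sim_mono xy xy' (conj xx' nxx').
move=> vw vw'; apply/idP/idP; first exact: le_mono.
by apply: le_mono; apply: sim_sym.
Qed.

(** The bridge from genuine order embeddings to [sim]: as the image is downward closed, predecessors
    of [v] and of [h v] correspond under [h], and induction applies. *)
Lemma embedding_sim (V W : wellOrder) (h : wo_sort V -> wo_sort W) :
  (forall u v, wo_le u v = wo_le (h u) (h v)) ->
  (forall v w, wo_lt w (h v) -> range h w) ->
  forall v, sim v (h v).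
Proof.
move=> h_le h_range.
have h_lt u v : wo_lt u v <-> wo_lt (h u) (h v).
  split=> -[uv nuv]; split; [by rewrite -h_le| |by rewrite h_le|].
  - move=> huv; apply: nuv; apply: wo_le_anti => //.
    by rewrite h_le huv wo_le_refl.
  - by move=> uvE; apply: nuv; rewrite uvE.
elim/wo_lt_ind => v IH; split=> [v' v'v|w' w'v].
  by exists (h v'); [apply/h_lt|apply: IH].
have [v' _ hv'] := h_range _ _ w'v; rewrite -hv' in w'v *.
by exists v'; [apply/h_lt|apply/IH/h_lt].
Qed.

(* [V] has the order type of the initial segment of [W] below [w]. *)
Definition shorter_at (V W : wellOrder) (w : wo_sort W) : Prop :=
  (forall v : wo_sort V, exists w', wo_lt w' w /\ sim v w') /\
  (forall w', wo_lt w' w -> exists v : wo_sort V, sim v w').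

(** For the converse, choice turns the matching into maps both ways; they are mutually inverse by
    [sim_inj] and respect the order by [sim_wo_le]. *)
Lemma wo_isoP (V W : wellOrder) :
  wo_iso V W <-> (forall v : wo_sort V, exists w : wo_sort W, sim v w) /\
                 (forall w : wo_sort W, exists v : wo_sort V, sim v w).
Proof.
split=> [[h [[g hK gK] h_le]]|[/choice[h hP] /choice[g gP]]].
  have h_sim : forall v, sim v (h v).
    by apply: embedding_sim => // v w _; exists (g w).
  split=> [v|w]; first by exists (h v).
  by exists (g w); rewrite -{2}(gK w).
exists h; split=> [|u v]; last exact: sim_wo_le.
exists g => [v|w]; last exact: sim_inj (hP _) (gP _).
exact: sim_inj (sim_sym (gP _)) (sim_sym (hP _)).
Qed.

Lemma wo_shorterP (V W : wellOrder) :
  wo_shorter V W <-> exists w : wo_sort W, shorter_at V w.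
Proof.
split=> [[w [h [h_le hE]]]|[w [/choice[h hP] hW]]].
  have h_lt v : wo_lt (h v) w.
    by have : range h (h v) by []; rewrite hE.
  have h_sim : forall v, sim v (h v).
    apply: embedding_sim => // v u uv; rewrite hE.
    exact: wo_lt_trans uv (h_lt v).
  exists w; split=> [v|w' w'w]; first by exists (h v).
  have [v _ <-] : range h w' by rewrite hE.
  by exists v.
exists w, h; split=> [u v|]; first exact: sim_wo_le (hP u).2 (hP v).2.
apply/seteqP; split=> [_ [v _ <-]|w' /[dup] w'w /hW[v vw']].
  exact: (hP v).1.
by exists v => //; apply: sim_inj (hP v).2 vw'.
Qed.

Lemma shorter_at_sim (U V W : wellOrder) (v : wo_sort V) (w : wo_sort W) :
  shorter_at U v -> sim v w -> shorter_at U w.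
Proof.
move=> [Uv vU] [vw wv]; split=> [u|w' /wv[v' /vU[u uv'] v'w']].
  have [v' [/vw[w' w'w v'w'] uv']] := Uv u.
  by exists w'; split=> //; apply: sim_trans v'w'.
by exists u; apply: sim_trans v'w'.
Qed.

Lemma shorter_at_trans (U V W : wellOrder) (v : wo_sort V) (w : wo_sort W) :
  shorter_at U v -> shorter_at V w -> exists2 w', wo_lt w' w & shorter_at U w'.
Proof.
move=> Uv [/(_ v)[w' [w'w vw']] _].
by exists w' => //; apply: shorter_at_sim vw'.
Qed.

Lemma wo_iso_refl (V : wellOrder) : wo_iso V V.
Proof. by exists id; split=> //; exists id. Qed.

Lemma wo_iso_sym (V W : wellOrder) : wo_iso V W -> wo_iso W V.
Proof.
move=> /wo_isoP[VW WV]; apply/wo_isoP.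
split=> [w|v]; first by have [v /sim_sym] := WV w; exists v.
by have [w /sim_sym] := VW v; exists w.
Qed.

Lemma wo_iso_trans (U V W : wellOrder) :
  wo_iso U V -> wo_iso V W -> wo_iso U W.
Proof.
move=> /wo_isoP[UV VU] /wo_isoP[VW WV]; apply/wo_isoP; split=> [u|w].
  have [v uv] := UV u; have [w vw] := VW v.
  by exists w; apply: sim_trans vw.
have [v vw] := WV w; have [u uv] := VU v.
by exists u; apply: sim_trans vw.
Qed.

Lemma shorter_at_iso (V V' W : wellOrder) (w : wo_sort W) :
  wo_iso V V' -> shorter_at V w -> shorter_at V' w.
Proof.
move=> /wo_isoP[VV' V'V] [Vw wV]; split=> [v'|w' w'w].
  have [v vv'] := V'V v'; have [w' [w'w vw']] := Vw v.
  by exists w'; split=> //; apply: sim_trans vw'; apply: sim_sym.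
have [v vw'] := wV _ w'w; have [v' vv'] := VV' v.
by exists v'; apply: sim_trans vw'; apply: sim_sym.
Qed.

Lemma wo_shorter_iso (V V' W W' : wellOrder) :
  wo_iso V V' -> wo_iso W W' -> wo_shorter V W -> wo_shorter V' W'.
Proof.
move=> VV' /wo_isoP[WW' _] /wo_shorterP[w Vw]; apply/wo_shorterP.
have [w' ww'] := WW' w; exists w'.
exact: shorter_at_sim (shorter_at_iso VV' Vw) ww'.
Qed.

Lemma wo_trichotomy (V W : wellOrder) :
  wo_shorter V W \/ wo_iso V W \/ wo_shorter W V.
Proof.
(* If all points of [X] but not all points of [Y] are matched, then [X] is
   shorter than [Y], at the least unmatched point of [Y]. *)
have total_shorter (X Y : wellOrder) :
    (forall x : wo_sort X, exists y : wo_sort Y, sim x y) ->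
    (exists y : wo_sort Y, ~ exists x : wo_sort X, sim x y) -> wo_shorter X Y.
  move=> XY /(wf_minimal (@wo_lt_wf _))[y [nXy ymin]]; apply/wo_shorterP.
  exists y; split=> [x|y' /ymin/contrapT //].
  have [y' xy'] := XY x; exists y'; split=> //.
  case: (wo_lt_trichotomy y' y) => // -[y'E|yy'].
    by case: nXy; exists x; rewrite -y'E.
  have [_ /(_ _ yy')[x' _ x'y]] := xy'.
  by case: nXy; exists x'.
case: (pselect (forall v : wo_sort V, exists w : wo_sort W, sim v w)) => VW;
  case: (pselect (forall w : wo_sort W, exists v : wo_sort V, sim v w)) => WV.
- by right; left; apply/wo_isoP.
- by left; apply: total_shorter => //; apply/existsNP.
- right; right; apply: total_shorter => [w|].
    by have [v /sim_sym] := WV w; exists v.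
  move/existsNP: VW => [v nv]; exists v => -[w /sim_sym wv].
  by apply: nv; exists w.
(* Both sides have unmatched points. The least ones, [v] and [w], have only matched predecessors,
   and the partners lie below [w] and [v] because being matched is inherited downwards ([sim_back]).
   Hence [v] and [w] match each other, a contradiction. *)
move/existsNP/(wf_minimal (@wo_lt_wf _)): VW => [v [nv vmin]].
move/existsNP/(wf_minimal (@wo_lt_wf _)): WV => [w [nw wmin]].
have sim_back (X Y : wellOrder) (x x' : wo_sort X) (y : wo_sort Y) :
    wo_lt x' x \/ x' = x -> sim x y -> exists y' : wo_sort Y, sim x' y'.
  by move=> [x'x [/(_ _ x'x)[y' _ ?] _]|->]; [exists y'|exists y].
apply: (False_ind _ (nv _)); exists w; split=> [v' v'v|w' w'w].
  have [w' v'w'] := contrapT (vmin _ v'v); exists w' => //.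
  case: (wo_lt_trichotomy w' w) => // ww'; exfalso; apply: nw.
  have [|u /sim_sym uw] := sim_back _ _ _ w _ _ (sim_sym v'w').
    by case: ww' => [->|]; [right|left].
  by exists u.
have [v' v'w'] := contrapT (wmin _ w'w); exists v' => //.
case: (wo_lt_trichotomy v' v) => // vv'; exfalso; apply: nv.
by apply: sim_back v'w'; case: vv' => [->|]; [right|left].
Qed.

(** * Ordinals *)

Lemma ord_class_iso (a : ordinalNumber) (V W : wellOrder) :
  ord_class a V -> ord_class a W <-> wo_iso V W.
Proof.
have [X ->] := ord_classP a => VX; split=> [WX|VW].
  exact: wo_iso_trans VX (wo_iso_sym WX).
exact: wo_iso_trans (wo_iso_sym VW) VX.
Qed.

Lemma ord_class_inhabited (a : ordinalNumber) : exists V, ord_class a V.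
Proof. by have [X ->] := ord_classP a; exists X; apply: wo_iso_refl. Qed.

Lemma ord_eq (a b : ordinalNumber) (V W : wellOrder) :
  ord_class a V -> ord_class b W -> wo_iso V W -> a = b.
Proof.
move=> aV bW VW.
have : ord_class a = ord_class b.
  apply/seteqP; split=> X.
    move=> /(ord_class_iso X aV) VX; apply/(ord_class_iso X bW).
    exact: wo_iso_trans (wo_iso_sym VW) VX.
  move=> /(ord_class_iso X bW) WX; apply/(ord_class_iso X aV).
  exact: wo_iso_trans VW WX.
case: a b {aV bW} => [ca Pa] [cb Pb] /= cE; rewrite cE in Pa *.
by rewrite (Prop_irrelevance Pa Pb).
Qed.

Lemma ord_ltP (a b : ordinalNumber) (V W : wellOrder) :
  ord_class a V -> ord_class b W ->
  ord_lt a b <-> exists w : wo_sort W, shorter_at V w.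
Proof.
move=> aV bW; rewrite -wo_shorterP.
split=> [[V' [W' [aV' bW']]]|]; last by exists V, W.
by apply: wo_shorter_iso; [rewrite -(ord_class_iso V aV')|
  rewrite -(ord_class_iso W bW')].
Qed.

Lemma ord_lt_trichotomy (a b : ordinalNumber) :
  ord_lt a b \/ a = b \/ ord_lt b a.
Proof.
have [V aV] := ord_class_inhabited a; have [W bW] := ord_class_inhabited b.
rewrite (ord_ltP aV bW) (ord_ltP bW aV) -!wo_shorterP.
case: (wo_trichotomy V W) => [|[VW|]]; [by left| |by right; right].
by right; left; apply: ord_eq VW.
Qed.

Lemma ord_lt_trans (b a c : ordinalNumber) :
  ord_lt a b -> ord_lt b c -> ord_lt a c.
Proof.
have [U aU] := ord_class_inhabited a; have [V bV] := ord_class_inhabited b.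
have [W cW] := ord_class_inhabited c.
rewrite (ord_ltP aU bV) (ord_ltP bV cW) (ord_ltP aU cW) => -[v Uv] [w Vw].
by have [w' _ Uw'] := shorter_at_trans Uv Vw; exists w'.
Qed.

(** Every ordinal below [a] occupies a position in one fixed well-order [V] representing [a]. If [P]
    had no minimal element, the least position occupied by a member of [P] could be lowered
    further. *)
Lemma ord_lt_wf : well_founded ord_lt.
Proof.
apply: wf_of_minimal => P [a Pa]; apply: contrapT => nmin.
have [V aV] := ord_class_inhabited a.
have descend b : P b -> exists2 c, P c & ord_lt c b.
  move=> Pb; apply: contrapT => nc; apply: nmin; exists b; split=> // c cb Pc.
  by apply: nc; exists c.
have [|v [[b Pb [W bW Wv]] vmin]] := @wf_minimal _ _
    [set v : wo_sort V |
       exists2 b, P b & exists2 W, ord_class b W & shorter_at W v]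
    (@wo_lt_wf V).
  have [c Pc ca] := descend a Pa; have [W cW] := ord_class_inhabited c.
  by have [v Wv] := (ord_ltP cW aV).1 ca; exists v, c => //; exists W.
have [c Pc cb] := descend b Pb; have [U cU] := ord_class_inhabited c.
have [w Uw] := (ord_ltP cU bW).1 cb.
have [v' v'v Uv'] := shorter_at_trans Uw Wv.
by apply: (vmin _ v'v); exists c => //; exists U.
Qed.

(** * Surreal numbers *)

(** The length is recovered from the signs: by [sgn_dom] it is the ordinal whose predecessors are
    exactly the places of nonzero sign. *)
Lemma No_eq (x y : No) : sgn x = sgn y -> x = y.
Proof.
move=> sE; have lE : len x = len y.
  have lenE b : ord_lt b (len x) <-> ord_lt b (len y).
    by rewrite -!sgn_dom sE.
  case: (ord_lt_trichotomy (len x) (len y)) => [|[|]] //.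
    by move=> /lenE /(wf_irr ord_lt_wf).
  by move=> /lenE /(wf_irr ord_lt_wf).
case: x y sE lE => [lx sx Px] [ly sy Py] /= sE lE.
rewrite {}sE {}lE in Px *.
by rewrite (Prop_irrelevance Px Py).
Qed.

Lemma sgn_ge_len (x : No) (b : ordinalNumber) :
  ~ ord_lt b (len x) -> sgn x b = Zero.
Proof. by move=> nb; apply: contrapT => /sgn_dom. Qed.

Lemma prec_trans (y x z : No) : prec x y -> prec y z -> prec x z.
Proof.
move=> [xy xyE] [yz yzE]; split=> [|b bx]; first exact: ord_lt_trans yz.
by rewrite xyE// yzE//; apply: ord_lt_trans xy.
Qed.

Lemma preceq_trans (y x z : No) : preceq x y -> preceq y z -> preceq x z.
Proof.
move=> [xy|->] // [yz|<-]; last by left.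
by left; apply: prec_trans yz.
Qed.

Lemma prec_wf : well_founded prec.
Proof.
apply: wf_of_minimal => P [x Px].
have [|b [[z Pz <-] bmin]] := @wf_minimal _ _ (len @` P) ord_lt_wf.
  by exists (len x), x.
by exists z; split=> // y [/bmin nP _] Py; apply: nP; exists y.
Qed.

(* If [l] first differs from [a] at [b] and [z] is an initial segment of [a],
   then either [z] is short enough to be an initial segment of [l] too, or [b]
   also separates [l] from [z]. *)
Lemma agree_below_prec (a z l : No) (b : ordinalNumber) :
  prec z a -> (forall c, ord_lt c b -> sgn l c = sgn a c) ->
  preceq z l \/
  (forall c, ord_lt c b -> sgn l c = sgn z c) /\ sgn z b = sgn a b.
Proof.
move=> [za zaE] laE; case: (pselect (ord_lt b (len z))) => [bz|nbz].
  right; split=> [c cb|]; last exact: zaE.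
  by rewrite laE// zaE//; apply: ord_lt_trans bz.
left; have zlE c : ord_lt c (len z) -> sgn z c = sgn l c.
  move=> cz; rewrite zaE// laE//.
  case: (ord_lt_trichotomy c b) => // -[cb|bc]; first by rewrite cb in cz.
  by case: nbz; apply: ord_lt_trans cz.
case: (ord_lt_trichotomy (len z) (len l)) => [zl|[lE|lz]]; first by left.
  right; apply/No_eq/funext => c.
  case: (pselect (ord_lt c (len z))) => [/zlE //|ncz].
  by rewrite !sgn_ge_len// -lE.
(* If [l] were shorter than [z], then at the place [len l] the sign of [z] would be nonzero and that
   of [l] would be [Zero], although the two agree below [len z]. *)
have : ord_lt (len l) (len l); last by move/(wf_irr ord_lt_wf).
by rewrite -sgn_dom -zlE// sgn_dom.
Qed.

(** Otherwise, by [agree_below_prec], the place separating [a] from an element of [L] or [R]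
    separates [z] from it as well. So [z] lies in the cut, and simplicity of [a] makes [a] an
    initial segment of its own proper initial segment [z]. *)
Lemma prec_cut (L R : set No) (a z : No) :
  is_cut L R a -> prec z a -> exists2 b, (L `|` R) b & preceq z b.
Proof.
move=> [[La aR] amin] za; apply: contrapT => nz.
have /amin az : separates L R z.
  split=> [l Ll|r Rr].
    have [b [laE lab]] := La _ Ll; exists b.
    have [zl|[lzE ->]] := agree_below_prec za laE; last by split.
    by case: nz; exists l => //; left.
  have [b [arE arb]] := aR _ Rr; exists b.
  have raE c : ord_lt c b -> sgn r c = sgn a c by move=> /arE.
  have [zr|[rzE ->]] := agree_below_prec za raE.
    by case: nz; exists r => //; right.
  by split=> // c /rzE.
have : prec z z by case: az => [|az]; [apply: prec_trans za|rewrite -{2}az].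
exact: wf_irr prec_wf.
Qed.

Lemma vec_prec_wf (n : nat) : well_founded (@vec_prec n).
Proof.
apply: wf_of_minimal => P [x0 Px0].
(* Minimize the coordinates one at a time. *)
have partial_min k : k <= n -> exists x, P x /\ forall y, P y ->
    vec_preceq y x -> forall i : 'I_n, i < k -> y i = x i.
  elim: k => [_|k IH kn]; first by exists x0.
  have [x [Px xmin]] := IH (ltnW kn); pose i0 := Ordinal kn.
  have [|_ [[y [Py yx] <-] ymin]] := @wf_minimal _ _
      [set y i0 | y in [set y | P y /\ vec_preceq y x]] prec_wf.
    by exists (x i0), x => //; split=> // i; right.
  (* A vector below [y] is also below [x], so its first [k] coordinates, like those of [y], are
     still the ones of [x]. Only coordinate [i0] needs the new minimality. *)
  exists y; split=> // z Pz zy i.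
  have zx : vec_preceq z x by move=> j; apply: preceq_trans (zy j) (yx j).
  rewrite ltnS leq_eqVlt => /orP[/eqP ik|ik]; last by rewrite !xmin.
  have {i ik} -> : i = i0 by apply: val_inj.
  by have [zy0|] := zy i0 => //; case: (ymin _ zy0); exists z.
have [x [Px xmin]] := partial_min n (leqnn n).
exists x; split=> // y [yx nyx] Py; apply: nyx; apply/funext => i.
by apply: xmin => //; apply: ltn_ord.
Qed.

(** * Initial closures *)

Definition initial_core (C : set No) : set No :=
  [set x | forall y, preceq y x -> C y].

Lemma initial_core_sub (C : set No) : initial_core C `<=` C.
Proof. by move=> x; apply; right. Qed.

Lemma initial_core_initial (C : set No) : is_initial (initial_core C).
Proof. by move=> x y Cx yx z zy; apply: Cx; apply: preceq_trans yx. Qed.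

Lemma sub_initial_core (C D : set No) :
  is_initial D -> D `<=` C -> D `<=` initial_core C.
Proof. by move=> Dinit DC x Dx y yx; apply/DC/Dinit/yx. Qed.

Lemma cl_closed (A : No_family) (D : set No) : closed_under A (cl A D).
Proof.
by move=> m g Ag v vD T TP; apply: TP.1 => // i; apply: vD.
Qed.

Lemma initial_core_closed (A : No_family) (C : set No) :
  (forall T, is_initial T -> is_initial (cl A T)) ->
  closed_under A C -> closed_under A (initial_core C).
Proof.
move=> A_initial Ccl.
have clC : cl A (initial_core C) `<=` initial_core C.
  apply: sub_initial_core; first exact: A_initial (@initial_core_initial C).
  by apply: smallest_sub => //; apply: initial_core_sub.
move=> m g Ag v vC; apply: clC; apply: cl_closed => // i.
exact: sub_gen_smallest.
Qed.

(** Serves both claims of the theorem: [U] is the union of the [S i] for the first, and empty for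
    the second. The last hypothesis ensures that any coordinates an option reads directly lie in
    [U]. *)
Lemma cl_recursive_initial (A : No_family) (n : nat) (f : No_fun n)
    (S : 'I_n -> set No) (U : set No) (L R : set (opt n)) :
  (forall T, is_initial T -> is_initial (cl A T)) ->
  (forall i, is_initial (S i)) -> is_initial U ->
  (forall o, (L `|` R) o -> A _ (opt_fun o)) -> defined_by f L R ->
  (forall o, (L `|` R) o -> values_only o \/ forall i, S i `<=` U) ->
  is_initial (cl A (U `|` f @` class_prod S)).
Proof.
move=> A_initial S_initial U_initial LRA fE LRU.
set C := cl A _; set T := initial_core C.
have Ccl : closed_under A C by apply: cl_closed.
have Tcl : closed_under A T by apply: initial_core_closed.
have genC : U `|` f @` class_prod S `<=` C by apply: sub_gen_smallest.
have UT : U `<=` T.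
  by apply: sub_initial_core => // x Ux; apply: genC; left.
have fT x : class_prod S x -> T (f x).
  elim/(well_founded_ind (@vec_prec_wf n)): x => x IH Sx.
  have opt_T o z : (L `|` R) o -> opt_values f x o z -> T z.
    move=> LRo [y [yx ->]]; apply: Tcl; first exact: LRA.
    (* Only the [y s] that [o] uses are constrained to be options of [x]; membership in the product
       is available just for these. *)
    move=> j; have yS s : opt_uses o s -> class_prod S (y s).
      by move=> /yx[[yx' _] _] i; apply: S_initial (yx' i).
    case: (LRU _ LRo) => [/(_ j)[s js]|SU].
      rewrite js /=; have so : opt_uses o s by exists j; left.
      by apply: IH (yS _ so); have [] := yx s so.
    case js : (opt_arg o j) => [i|s i|s] /=; first exact: UT (SU i _ (Sx i)).
      have so : opt_uses o s by exists j; right; exists i.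
      exact: UT (SU i _ (yS s so i)).
    have so : opt_uses o s by exists j; left.
    by apply: IH (yS _ so); have [] := yx s so.
  (* Membership of [f x] in the core concerns all its initial segments [z]. A proper one is an
     initial segment of an option value, already in [T]; [f x] itself is a generator of [C]. *)
  move=> z [zfx|->]; last by apply: genC; right; exists x.
  have [b + zb] := prec_cut (fE x) zfx.
  by case=> -[o LRo ob]; apply: opt_T ob _ zb; [left|right].
have CT : C `<=` T.
  by apply: smallest_sub => // _ [/UT //|[x Sx <-]]; apply: fT.
by move=> x y /CT Tx; apply: Tx.
Qed.

Theorem mainTheorem3 (A : No_family)
    (A_initial : forall T : set No, is_initial T -> is_initial (cl A T))
    (n : nat) (f : No_fun n) (f_rec : recursive_over A f)
    (S : 'I_n -> set No) (S_initial : forall i, is_initial (S i)) :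
  is_initial (cl A ((\bigcup_i S i) `|` f @` class_prod S)) /\
  (forall L R : set (opt n),
    opts_in A L -> opts_in A R -> defined_by f L R ->
    (forall o, (L `|` R) o -> values_only o) ->
    is_initial (cl A (f @` class_prod S))).
Proof.
split.
  have [L [R [[_ LA] [_ RA] fE]]] := f_rec.
  apply: cl_recursive_initial fE _ => //.
  - by move=> x y [i _ Six] yx; exists i => //; apply: S_initial Six yx.
  - by move=> o [/LA|/RA].
  - by right=> i x Six; exists i.
move=> L R [_ LA] [_ RA] fE LRv.
rewrite -[f @` _]set0U; apply: cl_recursive_initial fE _ => //.
  by move=> o [/LA|/RA].
by move=> o /LRv; left.
Qed.
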